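(* Let $a_1,\dots,a_k$ be positive integers with $\gcd(a_1,\dots,a_k)=1$, and let $\{p(n)\}_{n\ge0}$ be defined by $$\sum_{n\ge 0}p(n)x^n=\frac{1}{\prod_{i=1}^k(1-x^{a_i})}.$$ If there does not exist a prime that divides all but one of the $a_i$ (equivalently, if every $(k-1)$-element subset of $\{a_1,\dots,a_k\}$ has gcd $1$), then the sequence $\{p(n)\}$ is strictly increasing for all sufficiently large $n$. *)

(* Defs.v *)
From mathcomp Require Import all_boot all_order all_algebra.

Set Implicit Arguments.
Unset Strict Implicit.
Unset Printing Implicit Defensive.

Import Order.TTheory GRing.Theory Num.Theory.

Local Open Scope ring_scope.

(* A formal power series over R is represented by its coefficient sequence. *)
Definition fps (R : Type) := nat -> R.

Definition fps_of_poly (R : nzRingType) (P : {poly R}) : fps R := fun n => P`_n.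

Definition fps_mul (R : nzRingType) (f g : fps R) : fps R :=
  fun n => \sum_(i < n.+1) f i * g (n - i)%N.

(* f = 1 / g in R[[x]], i.e. f * g = 1; the series f is then determined by g. *)
Definition fps_is_inv (R : comNzRingType) (f g : fps R) : Prop :=
  fps_mul f g =1 fps_of_poly 1.

Definition partition_denominator (k : nat) (a : 'I_k -> nat) : {poly int} :=
  \prod_(i < k) (1 - 'X^(a i)).

(* Exactly one exception; "at most one" is the same notion when the gcd is 1. *)
Definition divides_all_but_one (q k : nat) (a : 'I_k -> nat) : Prop :=
  exists j : 'I_k, forall i : 'I_k, (q %| a i)%N = (i != j).

Definition eventually_strictly_increasing (p : nat -> int) : Prop :=
  exists N : nat, forall m n : nat, (N <= m)%N -> (m < n)%N -> p m < p n.

(* Main.v *)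
Require Import Defs.
From mathcomp Require Import all_boot all_order all_algebra all_field.
From mathcomp Require Import zify.

(** Put [m = k - 2], [M = a_1 ... a_k] and [G_n = 1 + x + ... + x^(n-1)].  By
    hypothesis each [d > 1] divides at most [m] of the [a_i], so every cyclotomic
    polynomial [Phi_d] with [d > 1] has multiplicity at most [m] in
    [G_(a_1) ... G_(a_k)], which therefore divides [G_M ^ m], with a quotient [R]
    such that [R(1) = M ^ m / (a_1 ... a_k) > 0].  Hence the generating series of
    [p n - p (n - 1)] is [R / ((1 - x) (1 - x ^ M) ^ m)].  The coefficients of
    [R / (1 - x)] are eventually equal to [R(1)], and dividing by [1 - x ^ M]
    preserves eventual positivity of integer coefficients. *)

Import Order.TTheory GRing.Theory Num.Theory.

Local Open Scope ring_scope.

(** * Divisors common to many of the [a i] *)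

Lemma dvdn_biggcdP (I : finType) (P : pred I) (F : I -> nat) (d : nat) :
  reflect (forall i, P i -> (d %| F i)%N) (d %| \big[gcdn/0%N]_(i | P i) F i)%N.
Proof.
rewrite (big_morph (fun n => d %| n)%N (op1 := andb) (id1 := true)
  (dvdn_gcd d) (dvdn0 d)) big_andE.
exact: forall_inP.
Qed.

Lemma neq1_prime_dvd (n : nat) :
  n <> 1%N -> exists2 q : nat, prime q & (q %| n)%N.
Proof.
case: n => [|[|n]] // _; first by exists 2%N.
by exists (pdiv n.+2); [exact: pdiv_prime | exact: pdiv_dvd].
Qed.

Section GcdCondition.

Variables (k : nat) (a : 'I_k -> nat).
Hypothesis gcd_a : \big[gcdn/0%N]_(i < k) a i = 1%N.

Lemma prime_not_dvd_all (q : nat) :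
  prime q -> (forall i, (q %| a i)%N) -> False.
Proof.
move=> q_pr q_dvd; suff: (q %| 1)%N by rewrite Euclid_dvd1.
by rewrite -gcd_a; apply/dvdn_biggcdP.
Qed.

Lemma prime_divides_all_but_one (q : nat) (j : 'I_k) :
  prime q -> (forall i, i != j -> (q %| a i)%N) -> divides_all_but_one q a.
Proof.
move=> q_pr q_dvd; exists j => i; case: eqVneq => [->|/q_dvd //].
apply/negP => q_dvdj; apply: (prime_not_dvd_all _ q_pr) => i'.
by have [->//|/q_dvd] := eqVneq i' j.
Qed.

(** The subsets in question are the complements of single indices [j]; a prime dividing such a gcd
    cannot divide [a j] as well, since the full gcd is 1. *)
Lemma no_prime_divides_all_but_oneP :
  (~ exists q : nat, prime q /\ divides_all_but_one q a) <->
  (forall S : {set 'I_k}, #|S| = k.-1 -> \big[gcdn/0%N]_(i in S) a i = 1%N).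
Proof.
split=> [no_q S cardS | gcdS [q [q_pr [j q_dvd]]]].
  (* The empty gcd is 0, so [gcd_a] rules out [k = 0], where [k.-1] would truncate. *)
  have k_gt0 : (0 < k)%N.
    by case: (k) a gcd_a => // a0; rewrite big_ord0.
  have /eqP/cards1P[j SCj] : #|~: S| = 1%N.
    by have := cardsC S; rewrite cardS card_ord; lia.
  apply/eqP; apply: contra_notT no_q.
  move=> /eqP/neq1_prime_dvd[q q_pr /dvdn_biggcdP q_dvd]; exists q; split=> //.
  apply: (prime_divides_all_but_one _ j) => // i i_neq_j; apply: q_dvd.
  by rewrite -[S]setCK SCj !inE.
have /gcdS gcd1 : #|~: [set j]| = k.-1.
  by have := cardsC [set j]; rewrite cards1 card_ord; lia.
have : (q %| 1)%N; last by rewrite Euclid_dvd1.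
by rewrite -gcd1; apply/dvdn_biggcdP => i; rewrite !inE q_dvd.
Qed.

(** A prime factor [q] of [d] misses some [a j] because the gcd is 1, and if [d] divided all the
    others, [q] would be a forbidden prime; so [d] misses two indices. *)
Lemma card_dvd_le (d : nat) :
  (~ exists q : nat, prime q /\ divides_all_but_one q a) ->
  d <> 1%N -> (#|[pred i | (d %| a i)%N]|.+2 <= k)%N.
Proof.
move=> no_q /neq1_prime_dvd[q q_pr q_dvd].
pose D := [pred i | (d %| a i)%N].
rewrite -[leqRHS]card_ord -(cardC D) -addn2 leq_add2l.
have [j NDj] : exists j, ~~ D j.
  apply/existsP; rewrite -negb_forall; apply/negP => /forallP all_d.
  by apply: (prime_not_dvd_all _ q_pr) => i; apply: dvdn_trans q_dvd (all_d i).
have [i /andP[ij NDi]] : exists i, (i != j) && ~~ D i.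
  apply/existsP; apply: contra_notT no_q; rewrite negb_exists => /forallP all_d.
  exists q; split=> //.
  apply: (prime_divides_all_but_one _ j) => // i ij.
  by have := all_d i; rewrite ij negbK; apply: dvdn_trans.
by apply/card_gt1P; exists i, j; split.
Qed.

End GcdCondition.

(** * Geometric sums and their cyclotomic factors *)

Definition geom_poly (n : nat) : {poly int} := \sum_(i < n) 'X^i.

Lemma geom_polyM (n : nat) : (1 - 'X) * geom_poly n = 1 - 'X^n.
Proof. by rewrite -opprB mulNr -subrX1 opprB. Qed.

Lemma horner_geom_poly1 (n : nat) : (geom_poly n).[1] = n%:R.
Proof.
rewrite horner_sum (eq_bigr (fun=> 1)) => [|i _]; last by rewrite hornerXn expr1n.
by rewrite sumr_const card_ord.
Qed.

Lemma prod_divisors_dvd (n M : nat) (F : nat -> {poly int}) :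
  (0 < M)%N -> (n %| M)%N ->
  \prod_(d <- divisors n) F d = \prod_(d <- divisors M | (d %| n)%N) F d.
Proof.
move=> M_gt0 n_dvd; rewrite -[RHS]big_filter; apply/perm_big/uniq_perm.
- exact: divisors_uniq.
- exact/filter_uniq/divisors_uniq.
move=> d; rewrite mem_filter -!dvdn_divisors ?(dvdn_gt0 M_gt0) //.
by case d_dvd: (d %| n)%N => //=; rewrite (dvdn_trans d_dvd).
Qed.

(** Cancel ['Phi_1 = 'X - 1] in the factorization of ['X^n - 1]. Indexing by the divisors of a
    common multiple [M] lets products over different [n] be exchanged. *)
Lemma geom_poly_Cyclotomic (n M : nat) :
  (0 < M)%N -> (n %| M)%N ->
  geom_poly n = \prod_(d <- divisors M | (d != 1)%N && (d %| n)%N) 'Phi_d.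
Proof.
move=> M_gt0 n_dvd.
have Phi1 : 'Phi_1 = 'X - 1 :> {poly int}.
  by rewrite -['X in RHS]expr1 -prod_Cyclotomic // big_seq1.
apply: (mulfI (monic_neq0 (monicXsubC (1 : int)))); rewrite -subrX1.
rewrite -prod_Cyclotomic ?(dvdn_gt0 M_gt0) // (prod_divisors_dvd _ _ _ M_gt0) //.
rewrite (bigID (fun d => d == 1%N)) /=; congr (_ * _); last first.
  by apply: eq_bigl => d; rewrite andbC.
rewrite -big_filter (_ : [seq d <- _ | _] = [:: 1%N]) ?big_seq1 ?Phi1 //.
apply: perm_small_eq => //; apply: uniq_perm => //.
  exact/filter_uniq/divisors_uniq.
move=> d; rewrite mem_filter inE -dvdn_divisors //.
by case: eqVneq => [->|]; rewrite ?dvd1n ?andbF.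
Qed.

Lemma prod_geom_poly_dvd (k m : nat) (a : 'I_k -> nat) (M : nat) :
  (0 < M)%N -> (forall i, (a i %| M)%N) ->
  (forall d : nat, d <> 1%N -> (#|[pred i | (d %| a i)%N]| <= m)%N) ->
  exists R : {poly int}, (\prod_(i < k) geom_poly (a i)) * R = geom_poly M ^+ m.
Proof.
move=> M_gt0 a_dvd card_le.
pose c d := #|[pred i | (d %| a i)%N]|.
(* ['Phi_d] occurs [c d] times in the product and [m] times in the target; [R] supplies the
   difference, and [card_le] keeps the subtraction from truncating. *)
exists (\prod_(d <- divisors M | d != 1%N) 'Phi_d ^+ (m - c d)).
rewrite (eq_bigr _ (fun i _ => geom_poly_Cyclotomic _ _ M_gt0 (a_dvd i))).
under eq_bigr => i _ do rewrite big_mkcondr.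
rewrite exchange_big -big_split /=.
rewrite (geom_poly_Cyclotomic _ _ M_gt0 (dvdnn M)) -prodrXl.
rewrite [RHS]big_seq_cond [LHS]big_seq_cond.
apply: eq_big => d; rewrite -dvdn_divisors //; first by case: (d %| M)%N; rewrite ?andbT.
move=> /andP[_ /eqP d_neq1].
by rewrite -big_mkcond prodr_const -exprD subnKC // card_le.
Qed.

(** * Multiplying series by polynomials, and eventual positivity *)

Section SeriesAction.

Implicit Types (u : nat -> int) (P Q : {poly int}).

(** Coefficients up to [N] see only the truncation of [u], so polynomial algebra applies to
    series. *)
Lemma fps_mulE (n N : nat) u P : (n <= N)%N ->
  fps_mul u (fps_of_poly P) n = ((\poly_(i < N.+1) u i) * P)`_n.
Proof.
move=> le_nN; rewrite coefM; apply: eq_bigr => i _; rewrite coef_poly.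
by rewrite (leq_trans (ltn_ord i)).
Qed.

Lemma fps_mulA u P Q :
  fps_mul (fps_mul u (fps_of_poly P)) (fps_of_poly Q)
    =1 fps_mul u (fps_of_poly (P * Q)).
Proof.
move=> n; rewrite [RHS](fps_mulE n n) // mulrA coefM; apply: eq_bigr => i _.
by rewrite (fps_mulE i n) // -ltnS.
Qed.

Lemma eq_fps_mull u v P : u =1 v ->
  fps_mul u (fps_of_poly P) =1 fps_mul v (fps_of_poly P).
Proof. by move=> uv n; apply: eq_bigr => i _; rewrite uv. Qed.

Lemma fps_mul1 P : fps_mul (fps_of_poly 1) (fps_of_poly P) =1 fps_of_poly P.
Proof.
move=> n; rewrite /fps_mul -[RHS]/(P`_n) -[P in RHS]mul1r coefM.
by apply: eq_bigr.
Qed.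

Lemma fps_mul_1subXn u (M n : nat) :
  fps_mul u (fps_of_poly (1 - 'X^M)) n
    = u n - (if (n < M)%N then 0 else u (n - M)%N).
Proof.
rewrite (fps_mulE n n) // mulrBr mulr1 coefB coefMXn !coef_poly ltnSn.
by rewrite (leq_ltn_trans (leq_subr M n) (ltnSn n)).
Qed.

Definition eventually_pos u : Prop :=
  exists N : nat, forall n : nat, (N <= n)%N -> 0 < u n.

(** [u] is the sequence of partial sums of the coefficients of [P], which is constantly [P.[1]] once
    all of them are included. *)
Lemma eventually_pos_sum u P :
  fps_mul u (fps_of_poly (1 - 'X)) =1 fps_of_poly P ->
  0 < P.[1] -> eventually_pos u.
Proof.
move=> uP P1; exists (size P) => n le_n.
have PE j : P`_j = u j - (if (j < 1)%N then 0 else u (j - 1)%N).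
  by rewrite -fps_mul_1subXn expr1 uP.
have -> : u n = \sum_(i < n.+1) P`_i.
  elim: n {le_n} => [|n IHn]; first by rewrite big_ord1 PE subr0.
  by rewrite big_ord_recr /= -IHn PE subn1 addrC subrK.
suff -> : \sum_(i < n.+1) P`_i = P.[1] by [].
rewrite (@horner_coef_wide _ n.+1) ?(leq_trans le_n) //.
by apply: eq_bigr => i _; rewrite expr1n mulr1.
Qed.

(** A positive integer is at least 1, so [u] eventually gains at least 1 per step of length [M] in
    each residue class. *)
Lemma eventually_pos_div u (M : nat) : (0 < M)%N ->
  eventually_pos (fps_mul u (fps_of_poly (1 - 'X^M))) -> eventually_pos u.
Proof.
move=> M_gt0 [N0 posN0].
have step n : (N0 + M <= n)%N -> u (n - M)%N + 1 <= u n.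
  move=> le_n; have [leN0 leM] : (N0 <= n)%N /\ (M <= n)%N by lia.
  by have := posN0 n leN0; rewrite fps_mul_1subXn ltnNge leM /=; lia.
(* [- C] bounds the starting values of all [M] classes from below, so [C.+1] steps make every class
   positive. *)
pose C := (\sum_(i < M) `|u (N0 + i)%N|)%N.
have lower_bound q r : (r < M)%N -> q%:Z - C%:Z <= u (N0 + r + q * M)%N.
  move=> lt_r; elim: q => [|q IHq].
    have : (`|u (N0 + r)%N| <= C)%N.
      by rewrite /C (bigD1 (Ordinal lt_r)) //= leq_addr.
    by rewrite mul0n addn0; lia.
  have := step (N0 + r + q.+1 * M)%N.
  rewrite (_ : (_ - M)%N = (N0 + r + q * M)%N); last by lia.
  by move=> /(_ _); lia.
exists (N0 + C.+1 * M)%N => n le_n.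
have := lower_bound ((n - N0) %/ M)%N ((n - N0) %% M)%N (ltn_pmod _ M_gt0).
rewrite -addnA [(_ %% _ + _)%N]addnC -divn_eq subnKC; last by lia.
have : (C.+1 <= (n - N0) %/ M)%N by rewrite leq_divRL //; lia.
by lia.
Qed.

Lemma eventually_pos_divX u (M m : nat) : (0 < M)%N ->
  eventually_pos (fps_mul u (fps_of_poly ((1 - 'X^M) ^+ m))) -> eventually_pos u.
Proof.
move=> M_gt0; elim: m u => [|m IHm] u [N posN].
  exists N => n /posN; rewrite expr0.
  by rewrite (fps_mulE n n) // mulr1 coef_poly ltnSn.
apply: (eventually_pos_div _ _ M_gt0); apply: IHm; exists N => n /posN.
by rewrite fps_mulA -exprS.
Qed.

Lemma eventually_pos_diff u :
  eventually_pos (fps_mul u (fps_of_poly (1 - 'X))) ->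
  eventually_strictly_increasing u.
Proof.
move=> [N posN]; exists N => m n le_m lt_mn.
rewrite -(subnKC lt_mn); elim: (n - m.+1)%N => [|i IHi].
  have := posN m.+1; rewrite -['X]expr1 fps_mul_1subXn subn1 addn0 /= subr_gt0.
  by apply; exact: leqW.
apply: lt_trans IHi _; rewrite addnS.
have := posN (m.+1 + i).+1; rewrite -['X]expr1 fps_mul_1subXn subn1 /= subr_gt0.
by apply; lia.
Qed.

End SeriesAction.

Theorem theorem3 (k : nat) (a : 'I_k -> nat) (p : nat -> int)
    (a_gt0 : forall i : 'I_k, (0 < a i)%N)
    (gcd_a : \big[gcdn/0%N]_(i < k) a i = 1%N)
    (p_def : fps_is_inv p (fps_of_poly (partition_denominator a))) :
  ((~ exists q : nat, prime q /\ divides_all_but_one q a) <->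
    (forall S : {set 'I_k}, #|S| = k.-1 ->
       \big[gcdn/0%N]_(i in S) a i = 1%N)) /\
  ((~ exists q : nat, prime q /\ divides_all_but_one q a) ->
    eventually_strictly_increasing p).
Proof.
split; first exact: no_prime_divides_all_but_oneP.
move=> no_q.
have card_le := card_dvd_le _ _ gcd_a _ no_q.
pose m := k.-2; pose M := (\prod_(i < k) a i)%N.
(* The case [d = 2] of [card_le] already forces [k] to be at least 2. *)
have k_eq : k = m.+2 by have := card_le 2%N; rewrite /m; lia.
have M_gt0 : (0 < M)%N by apply: prodn_gt0.
have a_dvd i : (a i %| M)%N by rewrite /M (bigD1 i) //= dvdn_mulr.
have [|R RE] := prod_geom_poly_dvd k m a M M_gt0 a_dvd.
  by move=> d /card_le; rewrite /m; lia.
have R1_gt0 : 0 < R.[1].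
  have := congr1 (fun P => P.[1]) RE.
  rewrite hornerM horner_prod horner_exp horner_geom_poly1.
  under eq_bigr => i _ do rewrite horner_geom_poly1.
  move=> R1; have : 0 < \prod_(i < k) ((a i)%:R : int) * R.[1].
    by rewrite R1 exprn_gt0 // ltr0n.
  by rewrite pmulr_rgt0 // prodr_gt0 // => i _; rewrite ltr0n.
(* Of the [m.+2] factors [1 - 'X], [m] turn [geom_poly M ^+ m] into [(1 - 'X^M) ^+ m]; of the two
   left, one takes differences of [p] and the other yields partial sums of [R]. *)
have denomR : partition_denominator a * R
    = (1 - 'X) * ((1 - 'X^M) ^+ m * (1 - 'X)).
  rewrite /partition_denominator.
  under eq_bigr => i _ do rewrite -geom_polyM.
  rewrite big_split prodr_const card_ord -mulrA RE -geom_polyM exprMn k_eq.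
  rewrite [_ ^+ m.+2]exprS [_ ^+ m.+1]exprSr -!mulrA; congr (_ * (_ * _)).
  by rewrite mulrC.
apply/eventually_pos_diff/(eventually_pos_divX _ M m M_gt0).
apply: (eventually_pos_sum _ R) R1_gt0 => n.
rewrite !fps_mulA -denomR -fps_mulA.
by rewrite (eq_fps_mull _ _ _ p_def) fps_mul1.
Qed.
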